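(* For every similarity relation ${\mathcal R}$, cut value $\mu$, and higher-order patterns $t,s$, the algorithm $\mathsf{HOPSU}$ started on the configuration $\{t\simeq^?_{{\mathcal R},\mu}s\};\varepsilon;1$ terminates, and it terminates either with a configuration of the form $\emptyset;\sigma;\mathfrak{d}$ or with $\bot$.
   Context: Terms: simply typed $\lambda$-terms over disjoint countably infinite sets $\mathcal{V}$ (typed variables) and $\mathcal{F}$ (typed constants), types $\tau::=\delta\mid\tau\to\tau$. Terms are identified modulo $\alpha$, kept $\beta$-normal, and $\eta$-expanded except that arguments of free variables are kept $\eta$-normal (i.e. are bound variables); a term is written $\lambda x_1,\dots,x_n.h(t_1,\dots,t_m)$ with head $h$. Free variables are written $F,G,H,X,Y,\dots$, bound variables $x,y,z,\dots$. A higher-order pattern is a term where every free variable occurrence is applied to a list of pairwise distinct bound variables; all terms in problems and substitutions are higher-order patterns. Substitutions $\sigma$ are type-preserving maps with finite domain $\mathit{Dom}(\sigma)=\{X\mid X\sigma\neq X\}$, applied postfix ($t\sigma$, capture-avoiding, followed by $\beta$-normalization); $\sigma\vartheta$ means first $\sigma$ then $\vartheta$; $\varepsilon$ is the identity; $\varphi|_V$ is the restriction to $V$; $\mathtt{fv}(t)$ is the set of free variables. Fuzzy setting: T-norm $\wedge=\min$. ${\mathcal R}_A$ is a similarity relation (reflexive, symmetric, min-transitive map to $[0,1]$) on $\mathcal{F}\cup\mathcal{V}$ with ${\mathcal R}_A(x,y)=0$ for distinct variables, ${\mathcal R}_A(f,g)=0$ for constants of different types, ${\mathcal R}_A(x,f)=0$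 for a variable and a constant. It induces ${\mathcal R}$ on terms: on normal forms ${\mathcal R}(a,b)={\mathcal R}_A(a,b)$ for symbols, ${\mathcal R}((t_1\,s_1),(t_2\,s_2))={\mathcal R}(t_1,t_2)\wedge{\mathcal R}(s_1,s_2)$, ${\mathcal R}(\lambda x.t,\lambda y.s)={\mathcal R}(t\{x\mapsto z\},s\{y\mapsto z\})$ for fresh $z$ of the same type, $0$ otherwise. A cut value is $\mu\in(0,1]$. An equation is written $t\simeq^?_{{\mathcal R},\mu}s$; a unification problem is a finite set of equations. Algorithm $\mathsf{HOPSU}$: it works on configurations $P;\sigma;\mathfrak{d}$ ($P$ a problem, $\sigma$ a substitution, $\mathfrak{d}\ge\mu$ a degree) or the failure configuration $\bot$, starting from $\{t\simeq^?_{{\mathcal R},\mu}s\};\varepsilon;1$ and applying the following rules to a selected equation as long as possible ($\uplus$ is disjoint union): (Abs) $\{\lambda x.t\simeq^?\lambda x.s\}\uplus P;\sigma;\mathfrak{d}\leadsto\{t\simeq^?s\}\cup P;\sigma;\mathfrak{d}$. (Dec) $\{f(t_1,\dots,t_n)\simeq^?g(s_1,\dots,s_n)\}\uplus P;\sigma;\mathfrak{d}\leadsto\{t_1\simeq^?s_1,\dots,t_n\simeq^?s_n\}\cup P;\sigma;\mathfrak{d}\wedge{\mathcal R}(f,g)$, where $f,g$ are rigid heads, $n\ge0$, and $\mathfrak{d}\wedge{\mathcal R}(f,g)\ge\mu$. (SV) $\{F(x_1,\dots,x_n)\simeq^?F(y_1,\dots,y_n)\}\uplus P;\sigma;\mathfrak{d}\leadsto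 P\vartheta;\sigma\vartheta;\mathfrak{d}$, where $\{z_1,\dots,z_m\}=\{x_i\mid x_i=y_i\}$ and $\vartheta=\{F\mapsto\lambda x_1,\dots,x_n.H(z_1,\dots,z_m)\}$ with $H$ fresh. (Ori) $\{a(s_1,\dots,s_m)\simeq^?F(x_1,\dots,x_n)\}\uplus P;\sigma;\mathfrak{d}\leadsto\{F(x_1,\dots,x_n)\simeq^?a(s_1,\dots,s_m)\}\cup P;\sigma;\mathfrak{d}$, where $F$ is free and $a$ is a constant or $a\in\{x_1,\dots,x_n\}$. (LF) $\{F(x_1,\dots,x_n)\simeq^?a(s_1,\dots,s_m)\}\uplus P;\sigma;\mathfrak{d}\leadsto P\vartheta;\sigma\vartheta;\mathfrak{d}$, where $F\notin\mathtt{fv}(a(s_1,\dots,s_m))$, $a$ is a constant, a free variable, or in $\{x_1,\dots,x_n\}$, $\mathsf{VarElim}(F(x_1,\dots,x_n),a(s_1,\dots,s_m))=\varphi$, and $\vartheta=\varphi|_V$ with $V=\{F\}\cup\mathtt{fv}(a(s_1,\dots,s_m))$. (Fail) $\{t\simeq^?s\}\uplus P;\sigma;\mathfrak{d}\leadsto\bot$ if no other rule applies to the selected equation. $\mathsf{VarElim}(t,s)$ starts from $\{t\simeq^?s\};\varepsilon$ and applies as long as possible: (VE1) $\{F(x_1,\dots,x_n)\simeq^?a(s_1,\dots,s_m)\}\uplus P;\sigma\leadsto\{H_1(x_1,\dots,x_n)\simeq^?s_1,\dots,H_m(x_1,\dots,x_n)\simeq^?s_m\}\cup P;\sigma\vartheta$,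 where $a$ is a constant or in $\{x_1,\dots,x_n\}$, $\vartheta=\{F\mapsto\lambda x_1,\dots,x_n.a(H_1(x_1,\dots,x_n),\dots,H_m(x_1,\dots,x_n))\}$ with $H_i$ fresh of appropriate types ($\eta$-expanded when needed); (VE2) $\{F(x_1,\dots,x_n)\simeq^?G(y_1,\dots,y_m)\}\uplus P;\sigma\leadsto P\vartheta;\sigma\vartheta$, where $\{x_1,\dots,x_n\}\cap\{y_1,\dots,y_m\}=\{z_1,\dots,z_k\}$ and $\vartheta=\{F\mapsto\lambda x_1,\dots,x_n.H(z_1,\dots,z_k),G\mapsto\lambda y_1,\dots,y_m.H(z_1,\dots,z_k)\}$ with $H$ fresh. If it ends in $\emptyset;\varphi$, then $\mathsf{VarElim}(t,s)=\varphi$. *)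

(* Defs.v *)
(* Simply typed lambda-terms in beta-normal, eta-long form
   (arguments of free variables kept eta-normal, i.e. bound variables),
   locally nameless: bound variables bound by a lambda are de Bruijn indices,
   bound variables that became "free" in an equation (after rule Abs / VE1)
   are named atoms. *)
From Stdlib Require Import List Arith Reals Relations.
Import ListNotations.

Inductive ty := Base (d : nat) | Arr (A B : ty).
Definition ty_eq_dec : forall A B : ty, {A = B} + {A <> B}.
Proof. decide equality; apply Nat.eq_dec. Defined.

Fixpoint ty_args (T : ty) : list ty :=
  match T with Base _ => [] | Arr A B => A :: ty_args B end.
Fixpoint ty_res (T : ty) : ty :=
  match T with Base d => Base d | Arr _ B => ty_res B end.
Definition arrows (As : list ty) (r : ty) : ty := fold_right Arr r As.

Record fvar := FV { fv_name : nat; fv_ty : ty }.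
Record cst := Cst { cst_name : nat; cst_ty : ty }.
Record atom := Atom { atom_name : nat; atom_ty : ty }.

Definition fvar_eq_dec : forall F G : fvar, {F = G} + {F <> G}.
Proof. decide equality; [apply ty_eq_dec | apply Nat.eq_dec]. Defined.
Definition cst_eq_dec : forall F G : cst, {F = G} + {F <> G}.
Proof. decide equality; [apply ty_eq_dec | apply Nat.eq_dec]. Defined.
Definition atom_eq_dec : forall F G : atom, {F = G} + {F <> G}.
Proof. decide equality; [apply ty_eq_dec | apply Nat.eq_dec]. Defined.

Inductive bv := BIdx (k : nat) | BAtom (a : atom).
Definition bv_eq_dec : forall x y : bv, {x = y} + {x <> y}.
Proof. decide equality; [apply Nat.eq_dec | apply atom_eq_dec]. Defined.

Inductive head := HC (c : cst) | HB (x : bv).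

Inductive tm :=
| Lam (A : ty) (b : tm)
| Rig (h : head) (args : list tm)
| Flex (F : fvar) (xs : list bv).

Definition eqn := (tm * tm)%type.

Definition bv_type (G : list ty) (x : bv) : option ty :=
  match x with BIdx k => nth_error G k | BAtom a => Some (atom_ty a) end.
Definition head_type (G : list ty) (h : head) : option ty :=
  match h with HC c => Some (cst_ty c) | HB x => bv_type G x end.

Inductive pattern (G : list ty) : tm -> ty -> Prop :=
| P_Lam A b B : pattern (A :: G) b B -> pattern G (Lam A b) (Arr A B)
| P_Rig h args tys d :
    head_type G h = Some (arrows tys (Base d)) ->
    Forall2 (pattern G) args tys ->
    pattern G (Rig h args) (Base d)
| P_Flex F xs tys d :
    fv_ty F = arrows tys (Base d) ->
    Forall2 (fun x T => bv_type G x = Some T) xs tys ->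
    NoDup xs ->
    pattern G (Flex F xs) (Base d).

Fixpoint fv (t : tm) : list fvar :=
  match t with
  | Lam _ b => fv b
  | Rig _ args => (fix go l := match l with [] => [] | u :: l' => fv u ++ go l' end) args
  | Flex F _ => [F]
  end.

Definition atoms_bv (x : bv) : list atom :=
  match x with BIdx _ => [] | BAtom a => [a] end.
Definition atoms_head (h : head) : list atom :=
  match h with HC _ => [] | HB x => atoms_bv x end.
Fixpoint atoms (t : tm) : list atom :=
  match t with
  | Lam _ b => atoms b
  | Rig h args => atoms_head h ++
      (fix go l := match l with [] => [] | u :: l' => atoms u ++ go l' end) args
  | Flex _ xs => flat_map atoms_bv xs
  end.

Definition fv_eqs (P : list eqn) : list fvar :=
  flat_map (fun e => fv (fst e) ++ fv (snd e)) P.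
Definition atoms_eqs (P : list eqn) : list atom :=
  flat_map (fun e => atoms (fst e) ++ atoms (snd e)) P.

Definition lams (As : list ty) (b : tm) : tm := fold_right Lam b As.

Definition idxs (n : nat) : list bv := map (fun j => BIdx (n - 1 - j)) (seq 0 n).

Definition eta (F : fvar) : tm :=
  let As := ty_args (fv_ty F) in lams As (Flex F (idxs (length As))).

Definition shift_bv (d : nat) (x : bv) : bv :=
  match x with BIdx j => BIdx (j + d) | BAtom a => BAtom a end.

(* replace the n outermost (stripped) binders, seen at depth d, by xs *)
Definition ren_bv (d n : nat) (xs : list bv) (x : bv) : bv :=
  match x with
  | BIdx k => if k <? d then BIdx k
              else if k - d <? n then shift_bv d (nth (n - 1 - (k - d)) xs (BIdx 0))
              else BIdx (k - n)
  | BAtom a => BAtom a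
  end.
Definition ren_head (d n : nat) (xs : list bv) (h : head) : head :=
  match h with HC c => HC c | HB x => HB (ren_bv d n xs x) end.
Fixpoint ren (d n : nat) (xs : list bv) (t : tm) : tm :=
  match t with
  | Lam A b => Lam A (ren (S d) n xs b)
  | Rig h args => Rig (ren_head d n xs h)
      ((fix go l := match l with [] => [] | u :: l' => ren d n xs u :: go l' end) args)
  | Flex F ys => Flex F (map (ren_bv d n xs) ys)
  end.

Fixpoint strip (n : nat) (t : tm) : tm :=
  match n, t with
  | S n', Lam _ b => strip n' b
  | _, _ => t
  end.

(* beta-normal form of (lambda x1..xn. u) applied to bound variables xs *)
Definition inst (u : tm) (xs : list bv) : tm :=
  ren 0 (length xs) xs (strip (length xs) u).

(* A substitution maps every free variable to a (closed) term; variables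
   outside the domain are mapped to their eta-expansion. *)
Definition subst := fvar -> tm.
Definition eps : subst := eta.

Fixpoint app_sub (s : subst) (t : tm) : tm :=
  match t with
  | Lam A b => Lam A (app_sub s b)
  | Rig h args => Rig h
      ((fix go l := match l with [] => [] | u :: l' => app_sub s u :: go l' end) args)
  | Flex F xs => inst (s F) xs
  end.

Definition sub_eq (s : subst) (e : eqn) : eqn := (app_sub s (fst e), app_sub s (snd e)).

(* sigma theta : first sigma, then theta *)
Definition comp (s th : subst) : subst := fun F => app_sub th (s F).

Definition restrict (s : subst) (V : list fvar) : subst :=
  fun F => if in_dec fvar_eq_dec F V then s F else eta F.

Definition used (P : list eqn) (s : subst) (H : fvar) : Prop :=
  In H (fv_eqs P) \/ s H <> eta H \/ (exists G, s G <> eta G /\ In H (fv (s G))).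

Definition open_bv (k : nat) (a : atom) (x : bv) : bv :=
  match x with BIdx j => if j =? k then BAtom a else BIdx j | BAtom b => BAtom b end.
Definition open_head k a h := match h with HC c => HC c | HB x => HB (open_bv k a x) end.
Fixpoint open_rec (k : nat) (a : atom) (t : tm) : tm :=
  match t with
  | Lam A b => Lam A (open_rec (S k) a b)
  | Rig h args => Rig (open_head k a h)
      ((fix go l := match l with [] => [] | u :: l' => open_rec k a u :: go l' end) args)
  | Flex F xs => Flex F (map (open_bv k a) xs)
  end.

Fixpoint open_lams (zs : list atom) (t : tm) : tm :=
  match zs, t with
  | a :: zs', Lam _ b => open_lams zs' (open_rec 0 a b)
  | _, _ => t
  end.

Fixpoint pos_of (x : bv) (l : list bv) : option nat :=
  match l with
  | [] => None
  | y :: l' => if bv_eq_dec x y then Some 0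
               else match pos_of x l' with Some j => Some (S j) | None => None end
  end.

(* abstract the atoms ys (to be bound by length ys outer lambdas), at depth d *)
Definition close_bv (d : nat) (ys : list bv) (x : bv) : bv :=
  match x with
  | BIdx _ => x
  | BAtom _ => match pos_of x ys with
               | Some j => BIdx (d + (length ys - 1 - j))
               | None => x
               end
  end.
Definition close_head d ys h := match h with HC c => HC c | HB x => HB (close_bv d ys x) end.
Fixpoint close_tm (d : nat) (ys : list bv) (t : tm) : tm :=
  match t with
  | Lam A b => Lam A (close_tm (S d) ys b)
  | Rig h args => Rig (close_head d ys h)
      ((fix go l := match l with [] => [] | u :: l' => close_tm d ys u :: go l' end) args)
  | Flex F xs => Flex F (map (close_bv d ys) xs)
  end.

Definition abstr (As : list ty) (xs : list bv) (body : tm) : tm :=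
  lams As (close_tm 0 xs body).

(* P = {e} disjoint-union P0, problems being read as finite sets *)
Definition sel (P : list eqn) (e : eqn) (P0 : list eqn) : Prop :=
  (forall x, In x P <-> x = e \/ In x P0) /\ ~ In e P0.

Definition head_ty (h : head) : ty :=
  match h with HC c => cst_ty c | HB (BAtom a) => atom_ty a | HB (BIdx _) => Base 0 end.

(* [avoid]: variables used by the enclosing HOPSU configuration (fresh
   variables must avoid them too). *)
Inductive ve_rstep (avoid : fvar -> Prop) :
    eqn -> list eqn -> subst -> list eqn -> subst -> Prop :=
| VE1 F xs a ss P0 phi (ch : list (fvar * list atom)) :
    (match a with HC _ => True | HB b => In b xs end) ->
    (* H_i fresh, of type (types of x1..xn) -> (argument types of s_i) -> base,
       together with fresh bound atoms for the leading lambdas of s_i *)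
    Forall2 (fun c Si => fv_ty (fst c) = arrows (ty_args (fv_ty F) ++ ty_args Si) (ty_res Si)
                        /\ map atom_ty (snd c) = ty_args Si)
            ch (ty_args (head_ty a)) ->
    length ch = length ss ->
    NoDup (map fst ch) ->
    Forall (fun H => ~ avoid H /\ ~ used ((Flex F xs, Rig a ss) :: P0) phi H) (map fst ch) ->
    NoDup (concat (map snd ch)) ->
    Forall (fun z => ~ In z (atoms_eqs ((Flex F xs, Rig a ss) :: P0))) (concat (map snd ch)) ->
    let newe := map (fun p => let '(s, (H, zs)) := p in
                              (Flex H (xs ++ map BAtom zs), open_lams zs s)) (combine ss ch) in
    let args' := map (fun c => let '(H, zs) := c in
                       abstr (map atom_ty zs) (map BAtom zs) (Flex H (xs ++ map BAtom zs))) ch in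
    let th : subst := fun K => if fvar_eq_dec K F
                               then abstr (ty_args (fv_ty F)) xs (Rig a args')
                               else eta K in
    ve_rstep avoid (Flex F xs, Rig a ss) P0 phi (newe ++ P0) (comp phi th)
| VE2 F xs G ys P0 phi n :
    let ps := filter (fun p => if in_dec bv_eq_dec (fst p) ys then true else false)
                     (combine xs (ty_args (fv_ty F))) in
    let zs := map fst ps in
    let H := FV n (arrows (map snd ps) (ty_res (fv_ty F))) in
    ~ avoid H -> ~ used ((Flex F xs, Flex G ys) :: P0) phi H ->
    let th : subst := fun K => if fvar_eq_dec K F then abstr (ty_args (fv_ty F)) xs (Flex H zs)
                               else if fvar_eq_dec K G then abstr (ty_args (fv_ty G)) ys (Flex H zs)
                               else eta K in
    ve_rstep avoid (Flex F xs, Flex G ys) P0 phi (map (sub_eq th) P0) (comp phi th).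

Definition ve_step (avoid : fvar -> Prop) (c c' : list eqn * subst) : Prop :=
  exists e P0, sel (fst c) e P0 /\ ve_rstep avoid e P0 (snd c) (fst c') (snd c').

Definition varelim (avoid : fvar -> Prop) (e : eqn) (phi : subst) : Prop :=
  clos_refl_trans _ (ve_step avoid) ([e], eps) ([], phi).

(* R_A restricted to constants; on variables it is forced by the axioms:
   R(x,x)=1, R(x,y)=0 for distinct variables, R(x,f)=0. *)
Record similarity := {
  simc : cst -> cst -> R;
  sim_range : forall f g, (0 <= simc f g <= 1)%R;
  sim_refl : forall f, simc f f = 1%R;
  sim_sym : forall f g, simc f g = simc g f;
  sim_trans : forall f g h, (Rmin (simc f g) (simc g h) <= simc f h)%R;
  sim_types : forall f g, cst_ty f <> cst_ty g -> simc f g = 0%R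
}.

Definition Rhead (Rs : similarity) (h1 h2 : head) : R :=
  match h1, h2 with
  | HC f, HC g => simc Rs f g
  | HB x, HB y => if bv_eq_dec x y then 1%R else 0%R
  | _, _ => 0%R
  end.

Inductive conf := Bot | Conf (P : list eqn) (s : subst) (d : R).

Inductive h_rstep (Rs : similarity) (mu : R) : eqn -> list eqn -> subst -> R -> conf -> Prop :=
| R_Abs A t s a P0 sg d :
    atom_ty a = A -> ~ In a (atoms_eqs ((Lam A t, Lam A s) :: P0)) ->
    h_rstep Rs mu (Lam A t, Lam A s) P0 sg d
      (Conf ((open_rec 0 a t, open_rec 0 a s) :: P0) sg d)
| R_Dec f g ts ss P0 sg d :
    length ts = length ss ->
    (mu <= Rmin d (Rhead Rs f g))%R ->
    h_rstep Rs mu (Rig f ts, Rig g ss) P0 sg d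
      (Conf (combine ts ss ++ P0) sg (Rmin d (Rhead Rs f g)))
| R_SV F xs ys P0 sg d n :
    length xs = length ys ->
    let ps := filter (fun p => let '(x, y, _) := p in if bv_eq_dec x y then true else false)
                     (combine (combine xs ys) (ty_args (fv_ty F))) in
    let zs := map (fun p => fst (fst p)) ps in
    let H := FV n (arrows (map snd ps) (ty_res (fv_ty F))) in
    ~ used ((Flex F xs, Flex F ys) :: P0) sg H ->
    let th : subst := fun K => if fvar_eq_dec K F then abstr (ty_args (fv_ty F)) xs (Flex H zs)
                               else eta K in
    h_rstep Rs mu (Flex F xs, Flex F ys) P0 sg d
      (Conf (map (sub_eq th) P0) (comp sg th) d)
| R_Ori a ss F xs P0 sg d :
    (match a with HC _ => True | HB b => In b xs end) ->
    h_rstep Rs mu (Rig a ss, Flex F xs) P0 sg d (Conf ((Flex F xs, Rig a ss) :: P0) sg d)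
| R_LF F xs r P0 sg d phi :
    (match r with
     | Rig (HC _) _ => True
     | Rig (HB b) _ => In b xs
     | Flex _ _ => True
     | Lam _ _ => False end) ->
    ~ In F (fv r) ->
    varelim (used ((Flex F xs, r) :: P0) sg) (Flex F xs, r) phi ->
    let th := restrict phi (F :: fv r) in
    h_rstep Rs mu (Flex F xs, r) P0 sg d (Conf (map (sub_eq th) P0) (comp sg th) d).

Inductive h_step (Rs : similarity) (mu : R) : conf -> conf -> Prop :=
| HS_rule P sg d e P0 C :
    sel P e P0 -> h_rstep Rs mu e P0 sg d C -> h_step Rs mu (Conf P sg d) C
| HS_Fail P sg d e P0 :
    sel P e P0 -> (forall C, ~ h_rstep Rs mu e P0 sg d C) -> h_step Rs mu (Conf P sg d) Bot.

(* Main.v *)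
Require Import Defs.
From Stdlib Require Import List Reals Relations Wellfounded Arith Lia ClassicalEpsilon Classical.
Import ListNotations.

(* Termination comes from a lexicographic measure on problems, read as sets of
   equations: the number of distinct free variables, the number of occurrences
   of free variables, and the total size.  Abs, Dec and Ori shrink the size
   without increasing the other two components, and SV deletes two occurrences.
   LF deletes at least one variable: VarElim(F(xs), r) instantiates F and the
   variables of r by terms with at most |fv r| free variables in all.  This is
   an invariant of VarElim: left-hand-side heads are pairwise distinct and never
   occur on right-hand sides, and the remaining variables never outnumber fv r,
   because VE1 only trades a head for fresh heads and VE2 only merges a
   right-hand-side variable into a fresh one.  Finally, a non-empty problem
   always has a successor, through Fail if through nothing else. *)

(* Problems are lists read as finite sets; a classical equality test lets us
   deduplicate lists over any type. *)
Definition classic_eq_dec {A : Type} : forall x y : A, {x = y} + {x <> y} :=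
  fun x y => excluded_middle_informative (x = y).

(** * Weighted finite sets *)

Section SetWeight.
Context {A : Type} (w : A -> nat).

Definition weight (l : list A) : nat := list_sum (map w l).
Definition set_weight (l : list A) : nat := weight (nodup classic_eq_dec l).

Lemma weight_app l1 l2 : weight (l1 ++ l2) = weight l1 + weight l2.
Proof. unfold weight; rewrite map_app, list_sum_app; reflexivity. Qed.

Lemma weight_le_pointwise (w' : A -> nat) l :
  (forall x, In x l -> w x <= w' x) -> weight l <= list_sum (map w' l).
Proof.
  induction l as [|x l IH]; intros H; unfold weight in *; simpl; auto.
  specialize (IH (fun y Hy => H y (or_intror Hy))). specialize (H x (or_introl eq_refl)). lia.
Qed.

Lemma NoDup_incl_weight a : forall b, NoDup a -> NoDup b -> incl a b -> weight a <= weight b.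
Proof.
  induction a as [|x a IH]; intros b Ha Hb Hab; [unfold weight; simpl; lia|].
  assert (Hx : In x b) by (apply Hab; left; reflexivity).
  destruct (in_split _ _ Hx) as [b1 [b2 ->]].
  inversion Ha; subst.
  assert (IH' : weight a <= weight (b1 ++ b2)).
  { apply IH; [assumption | eapply NoDup_remove_1; eassumption |].
    intros y Hy. assert (Hy' : In y (b1 ++ x :: b2)) by (apply Hab; right; exact Hy).
    apply in_app_or in Hy'; apply in_or_app; destruct Hy' as [H|[H|H]]; auto.
    subst; contradiction. }
  rewrite weight_app in *. unfold weight in *; simpl. lia.
Qed.

Lemma set_weight_incl a b : incl a b -> set_weight a <= set_weight b.
Proof.
  intros H; apply NoDup_incl_weight; try apply NoDup_nodup.
  intros x Hx; apply nodup_In, H, (nodup_In classic_eq_dec); exact Hx.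
Qed.

Lemma set_weight_ext a b : (forall x, In x a <-> In x b) -> set_weight a = set_weight b.
Proof. intros H; apply Nat.le_antisymm; apply set_weight_incl; intros x; apply H. Qed.

Lemma set_weight_cons_notin x a : ~ In x a -> set_weight (x :: a) = w x + set_weight a.
Proof. intros H; unfold set_weight; simpl; destruct (in_dec _ x a); [contradiction | reflexivity]. Qed.

Lemma set_weight_cons_in x a : In x a -> set_weight (x :: a) = set_weight a.
Proof. intros H; unfold set_weight; simpl; destruct (in_dec _ x a); [reflexivity | contradiction]. Qed.

Lemma set_weight_cons_le x a : set_weight (x :: a) <= w x + set_weight a.
Proof. unfold set_weight, weight; simpl; destruct (in_dec _ x a); simpl; lia. Qed.

Lemma set_weight_app_le a b : set_weight (a ++ b) <= weight a + set_weight b.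
Proof.
  induction a as [|x a IH]; [unfold weight; simpl; lia|].
  change ((x :: a) ++ b) with (x :: (a ++ b)). change (weight (x :: a)) with (w x + weight a).
  pose proof (set_weight_cons_le x (a ++ b)). lia.
Qed.

Lemma set_weight_app_le_sum a b : set_weight (a ++ b) <= set_weight a + set_weight b.
Proof.
  rewrite (set_weight_ext (a ++ b) (nodup classic_eq_dec a ++ b)); [apply set_weight_app_le|].
  intros x; rewrite !in_app_iff, (nodup_In classic_eq_dec); reflexivity.
Qed.

Lemma set_weight_app_disjoint a b :
  (forall x, In x a -> ~ In x b) -> set_weight a + set_weight b <= set_weight (a ++ b).
Proof.
  intros H. unfold set_weight. rewrite <- weight_app. apply NoDup_incl_weight.
  - apply NoDup_app; try apply NoDup_nodup.
    intros x H1 H2; apply nodup_In in H1; apply nodup_In in H2; eapply H; eauto.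
  - apply NoDup_nodup.
  - intros x Hx; rewrite nodup_In, in_app_iff; rewrite in_app_iff, !nodup_In in Hx; exact Hx.
Qed.

Lemma set_weight_remove x a : In x a -> set_weight a = w x + set_weight (remove classic_eq_dec x a).
Proof.
  intros H. rewrite (set_weight_ext a (x :: remove classic_eq_dec x a)).
  - apply set_weight_cons_notin, remove_In.
  - intros y; simpl; split.
    + intros Hy; destruct (classic_eq_dec x y); auto. right; apply in_in_remove; auto.
    + intros [<-|Hy]; auto. apply in_remove in Hy; tauto.
Qed.

End SetWeight.

Lemma set_weight_map_le {A B} (wA : A -> nat) (wB : B -> nat) (f : A -> B) l :
  (forall x, In x l -> wB (f x) <= wA x) -> set_weight wB (map f l) <= set_weight wA l.
Proof.
  induction l as [|x l IH]; intros H; [apply Nat.le_0_l|].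
  specialize (IH (fun y Hy => H y (or_intror Hy))).
  change (map f (x :: l)) with (f x :: map f l).
  destruct (in_dec classic_eq_dec x l) as [Hi|Hi].
  - rewrite set_weight_cons_in by (apply in_map; exact Hi).
    rewrite (set_weight_cons_in wA) by exact Hi. exact IH.
  - rewrite (set_weight_cons_notin wA) by exact Hi. eapply Nat.le_trans; [apply set_weight_cons_le|].
    specialize (H x (or_introl eq_refl)). lia.
Qed.

Definition card {A} (l : list A) : nat := set_weight (fun _ => 1) l.

Lemma card_incl {A} (l l' : list A) : incl l l' -> card l <= card l'.
Proof. apply set_weight_incl. Qed.

(** * Free variables of terms *)

Fixpoint tm_nested_ind (P : tm -> Prop)
  (HL : forall A b, P b -> P (Lam A b))
  (HR : forall h args, Forall P args -> P (Rig h args))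
  (HF : forall F xs, P (Flex F xs)) (t : tm) : P t :=
  match t with
  | Lam A b => HL A b (tm_nested_ind P HL HR HF b)
  | Rig h args => HR h args ((fix go (l : list tm) : Forall P l :=
       match l with
       | [] => Forall_nil _
       | u :: l' => Forall_cons _ (tm_nested_ind P HL HR HF u) (go l')
       end) args)
  | Flex F xs => HF F xs
  end.

Fixpoint tm_size (t : tm) : nat :=
  match t with
  | Lam _ b => S (tm_size b)
  | Rig _ args => S ((fix go l := match l with [] => 0 | u :: l' => S (tm_size u) + go l' end) args)
  | Flex _ _ => 1
  end.

Fixpoint flex_count (t : tm) : nat :=
  match t with
  | Lam _ b => flex_count b
  | Rig _ args => (fix go l := match l with [] => 0 | u :: l' => flex_count u + go l' end) args
  | Flex _ _ => 1
  end.

Lemma tm_size_Rig h args : tm_size (Rig h args) = S (list_sum (map (fun u => S (tm_size u)) args)).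
Proof. induction args; simpl in *; auto. Qed.
Lemma flex_count_Rig h args : flex_count (Rig h args) = list_sum (map flex_count args).
Proof. induction args; simpl in *; auto. Qed.
Lemma fv_Rig h args : fv (Rig h args) = flat_map fv args.
Proof. induction args; simpl in *; auto. Qed.
Lemma open_rec_Rig k a h args :
  open_rec k a (Rig h args) = Rig (open_head k a h) (map (open_rec k a) args).
Proof. simpl; f_equal; induction args; simpl; f_equal; auto. Qed.
Lemma ren_Rig d n xs h args : ren d n xs (Rig h args) = Rig (ren_head d n xs h) (map (ren d n xs) args).
Proof. simpl; f_equal; induction args; simpl; f_equal; auto. Qed.
Lemma close_tm_Rig d ys h args :
  close_tm d ys (Rig h args) = Rig (close_head d ys h) (map (close_tm d ys) args).
Proof. simpl; f_equal; induction args; simpl; f_equal; auto. Qed.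
Lemma app_sub_Rig s h args : app_sub s (Rig h args) = Rig h (map (app_sub s) args).
Proof. simpl; f_equal; induction args; simpl; f_equal; auto. Qed.

Lemma flat_map_map_id {B} (f : tm -> list B) g l :
  Forall (fun u => f (g u) = f u) l -> flat_map f (map g l) = flat_map f l.
Proof. induction 1; simpl; congruence. Qed.
Lemma list_sum_map_map_id (f : tm -> nat) g l :
  Forall (fun u => f (g u) = f u) l -> list_sum (map f (map g l)) = list_sum (map f l).
Proof. induction 1; simpl; congruence. Qed.

Lemma open_rec_shape t : forall k a,
  fv (open_rec k a t) = fv t /\ flex_count (open_rec k a t) = flex_count t /\
  tm_size (open_rec k a t) = tm_size t.
Proof.
  induction t as [A b IH|h args IH|F xs] using tm_nested_ind; intros k a.
  - simpl. destruct (IH (S k) a) as [? [? ?]]. repeat split; congruence.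
  - rewrite open_rec_Rig, !fv_Rig, !flex_count_Rig, !tm_size_Rig. repeat split.
    + apply flat_map_map_id. eapply Forall_impl; [|exact IH]. intros u Hu; apply Hu.
    + apply list_sum_map_map_id. eapply Forall_impl; [|exact IH]. intros u Hu; apply Hu.
    + f_equal. rewrite map_map. induction IH as [|u l Hu _ IHl]; simpl; auto.
      destruct (Hu k a) as [_ [_ ->]]. congruence.
  - simpl; auto.
Qed.

Lemma ren_shape t : forall d n xs, fv (ren d n xs t) = fv t /\ flex_count (ren d n xs t) = flex_count t.
Proof.
  induction t as [A b IH|h args IH|F ys] using tm_nested_ind; intros d n xs.
  - simpl. destruct (IH (S d) n xs). split; congruence.
  - rewrite ren_Rig, !fv_Rig, !flex_count_Rig. split.
    + apply flat_map_map_id. eapply Forall_impl; [|exact IH]. intros u Hu; apply Hu.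
    + apply list_sum_map_map_id. eapply Forall_impl; [|exact IH]. intros u Hu; apply Hu.
  - simpl; auto.
Qed.

Lemma close_tm_shape t : forall d ys,
  fv (close_tm d ys t) = fv t /\ flex_count (close_tm d ys t) = flex_count t.
Proof.
  induction t as [A b IH|h args IH|F xs] using tm_nested_ind; intros d ys.
  - simpl. destruct (IH (S d) ys). split; congruence.
  - rewrite close_tm_Rig, !fv_Rig, !flex_count_Rig. split.
    + apply flat_map_map_id. eapply Forall_impl; [|exact IH]. intros u Hu; apply Hu.
    + apply list_sum_map_map_id. eapply Forall_impl; [|exact IH]. intros u Hu; apply Hu.
  - simpl; auto.
Qed.

Lemma strip_shape n : forall t, fv (strip n t) = fv t /\ flex_count (strip n t) = flex_count t.
Proof. induction n; intros t; simpl; auto. destruct t; simpl; auto. Qed.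

Lemma lams_shape As b : fv (lams As b) = fv b /\ flex_count (lams As b) = flex_count b.
Proof. induction As; simpl; auto. Qed.

Lemma inst_shape u xs : fv (inst u xs) = fv u /\ flex_count (inst u xs) = flex_count u.
Proof.
  unfold inst. destruct (ren_shape (strip (length xs) u) 0 (length xs) xs).
  destruct (strip_shape (length xs) u). split; congruence.
Qed.

Lemma abstr_shape As xs b : fv (abstr As xs b) = fv b /\ flex_count (abstr As xs b) = flex_count b.
Proof.
  unfold abstr. destruct (lams_shape As (close_tm 0 xs b)). destruct (close_tm_shape b 0 xs).
  split; congruence.
Qed.

Lemma fv_abstr As xs b : fv (abstr As xs b) = fv b.
Proof. apply abstr_shape. Qed.

Lemma fv_eta K : fv (eta K) = [K].
Proof. apply lams_shape. Qed.

Lemma flex_count_eta K : flex_count (eta K) = 1.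
Proof. apply lams_shape. Qed.

Lemma fv_open_lams zs : forall t, fv (open_lams zs t) = fv t.
Proof.
  induction zs as [|z zs IH]; intros t; simpl; auto.
  destruct t; auto. rewrite IH. apply (open_rec_shape t 0 z).
Qed.

Lemma in_fv_app_sub s t x : In x (fv (app_sub s t)) <-> exists K, In K (fv t) /\ In x (fv (s K)).
Proof.
  revert x; induction t as [A b IH|h args IH|F xs] using tm_nested_ind; intros x.
  - apply IH.
  - rewrite app_sub_Rig, !fv_Rig, flat_map_concat_map, map_map, <- flat_map_concat_map, in_flat_map.
    rewrite Forall_forall in IH. split.
    + intros [u [Hu Hx]]. apply IH in Hx; [|exact Hu]. destruct Hx as [K [HK HK']].
      exists K; split; [apply in_flat_map; eauto | exact HK'].
    + intros [K [HK HK']]. apply in_flat_map in HK. destruct HK as [u [Hu HKu]].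
      exists u; split; [exact Hu|]. apply IH; eauto.
  - simpl. rewrite (proj1 (inst_shape _ _)). split.
    + intros H; exists F; simpl; auto.
    + intros [K [[<-|[]] HK]]; exact HK.
Qed.

Lemma flex_count_app_sub s : (forall K, flex_count (s K) = 1) ->
  forall t, flex_count (app_sub s t) = flex_count t.
Proof.
  intros Hs t. induction t as [A b IH|h args IH|F xs] using tm_nested_ind.
  - exact IH.
  - rewrite app_sub_Rig, !flex_count_Rig. apply list_sum_map_map_id, IH.
  - simpl. rewrite (proj2 (inst_shape _ _)). apply Hs.
Qed.

Lemma in_fv_eqs Q x :
  In x (fv_eqs Q) <-> exists e, In e Q /\ (In x (fv (fst e)) \/ In x (fv (snd e))).
Proof.
  unfold fv_eqs; rewrite in_flat_map.
  split; intros [e [H1 H2]]; exists e; split; auto; apply in_app_iff; auto.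
Qed.

Definition lhs_fv (Q : list eqn) : list fvar := flat_map (fun e => fv (fst e)) Q.

Lemma in_lhs_fv Q K : In K (lhs_fv Q) <-> exists e, In e Q /\ In K (fv (fst e)).
Proof. apply in_flat_map. Qed.

Lemma lhs_fv_app Q1 Q2 : lhs_fv (Q1 ++ Q2) = lhs_fv Q1 ++ lhs_fv Q2.
Proof. apply flat_map_app. Qed.

Lemma in_fv_eqs_sub th Q x :
  In x (fv_eqs (map (sub_eq th) Q)) -> exists K, In K (fv_eqs Q) /\ In x (fv (th K)).
Proof.
  rewrite in_fv_eqs. intros [e' [He' Hx]]. apply in_map_iff in He'. destruct He' as [e [<- He]].
  destruct Hx as [Hx|Hx]; apply in_fv_app_sub in Hx; destruct Hx as [K [HK Hx]];
    exists K; split; auto; apply in_fv_eqs; eauto.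
Qed.

Lemma in_combine_exists_l {A B} (l1 : list A) (l2 : list B) b :
  length l1 = length l2 -> In b l2 -> exists a, In (a, b) (combine l1 l2).
Proof.
  revert l2; induction l1 as [|x l1 IH]; intros [|y l2] Hl Hb; simpl in *;
    try discriminate; try contradiction.
  destruct Hb as [<-|Hb]; eauto. destruct (IH l2) as [a' Ha]; eauto.
Qed.

Lemma combine_NoDup_map_r {A B C} (f : B -> C) (l1 : list A) l2 a1 b1 a2 b2 :
  NoDup (map f l2) -> In (a1, b1) (combine l1 l2) -> In (a2, b2) (combine l1 l2) ->
  f b1 = f b2 -> (a1, b1) = (a2, b2).
Proof.
  revert l2; induction l1 as [|x l1 IH]; intros [|y l2] Hnd H1 H2 Hf; simpl in *; try contradiction.
  inversion Hnd as [|? ? Hy Hnd']; subst.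
  destruct H1 as [E1|H1]; destruct H2 as [E2|H2].
  - congruence.
  - inversion E1; subst. exfalso; apply Hy. rewrite Hf. apply in_map. eapply in_combine_r; eauto.
  - inversion E2; subst. exfalso; apply Hy. rewrite <- Hf. apply in_map. eapply in_combine_r; eauto.
  - eapply IH; eauto.
Qed.

(** * The invariant of VarElim *)

Section VarElim.
Variables (F0 : fvar) (r0 : tm).

Definition elim_vars : list fvar := F0 :: fv r0.
Definition image (phi : subst) : list fvar := flat_map (fun K => fv (phi K)) elim_vars.

(* Left-hand-side heads are the variables VarElim is about to instantiate; all
   other variables are at most merged (by VE2), so their number never grows. *)
Definition kept_vars (Q : list eqn) (phi : subst) : list fvar :=
  filter (fun x => if in_dec fvar_eq_dec x (lhs_fv Q) then false else true) (fv_eqs Q ++ image phi).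

Lemma in_image phi x : In x (image phi) <-> exists K, In K elim_vars /\ In x (fv (phi K)).
Proof. apply in_flat_map. Qed.

Lemma in_kept_vars Q phi x :
  In x (kept_vars Q phi) <-> (In x (fv_eqs Q) \/ In x (image phi)) /\ ~ In x (lhs_fv Q).
Proof.
  unfold kept_vars; rewrite filter_In, in_app_iff.
  destruct (in_dec fvar_eq_dec x (lhs_fv Q)); intuition congruence.
Qed.

Record ve_invariant (Q : list eqn) (phi : subst) : Prop := {
  lhs_fv_not_in_rhs : forall e K, In e Q -> In K (lhs_fv Q) -> ~ In K (fv (snd e));
  lhs_fv_determines_eqn : forall e1 e2 K, In e1 Q -> In e2 Q ->
    In K (fv (fst e1)) -> In K (fv (fst e2)) -> e1 = e2;
  card_kept_vars : card (kept_vars Q phi) <= card (fv r0) }.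

Lemma ve_invariant_ext Q Q' phi :
  (forall e, In e Q <-> In e Q') -> ve_invariant Q phi -> ve_invariant Q' phi.
Proof.
  intros HQ [I1 I2 I3].
  assert (HL : forall K, In K (lhs_fv Q) <-> In K (lhs_fv Q')).
  { intros K; rewrite !in_lhs_fv; split; intros [e [He HK]]; exists e; split; auto; apply HQ; auto. }
  assert (HV : forall K, In K (fv_eqs Q) <-> In K (fv_eqs Q')).
  { intros K; rewrite !in_fv_eqs; split; intros [e [He HK]]; exists e; split; auto; apply HQ; auto. }
  split.
  - intros e K He HK. apply (I1 e K); [apply HQ | apply HL]; assumption.
  - intros e1 e2 K H1 H2; apply I2; apply HQ; assumption.
  - unfold card in *. rewrite <- I3. apply Nat.eq_le_incl, set_weight_ext. intros x.
    rewrite !in_kept_vars, HV, HL. reflexivity.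
Qed.

Lemma ve_invariant_init xs : ~ In F0 (fv r0) -> ve_invariant [(Flex F0 xs, r0)] eps.
Proof.
  intros HF. split.
  - intros e K [<-|[]] HK. simpl in HK. destruct HK as [<-|[]]. exact HF.
  - intros e1 e2 K [<-|[]] [<-|[]]; reflexivity.
  - apply card_incl. intros x Hx. apply in_kept_vars in Hx. destruct Hx as [Hx Hnl].
    simpl in Hnl. destruct Hx as [Hx|Hx].
    + simpl in Hx. rewrite app_nil_r in Hx. destruct Hx as [<-|Hx]; tauto.
    + apply in_image in Hx. destruct Hx as [K [HK Hx]]. unfold eps in Hx. rewrite fv_eta in Hx.
      destruct Hx as [<-|[]]. destruct HK as [<-|HK]; tauto.
Qed.

Lemma card_image_le phi : ve_invariant [] phi -> card (image phi) <= card (fv r0).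
Proof.
  intros [_ _ I3]. eapply Nat.le_trans; [|exact I3].
  apply card_incl. intros x Hx. apply in_kept_vars. simpl; auto.
Qed.

Section EliminateRigid.
Variables (F : fvar) (xs : list bv) (r : tm) (P0 : list eqn) (phi : subst)
          (newe : list eqn) (th : subst).
Hypothesis new_lhs_fresh : forall K, In K (lhs_fv newe) -> ~ In K (fv_eqs ((Flex F xs, r) :: P0)).
Hypothesis new_lhs_unique : forall e1 e2 K, In e1 newe -> In e2 newe ->
  In K (fv (fst e1)) -> In K (fv (fst e2)) -> e1 = e2.
Hypothesis new_rhs_fv : forall e1 x, In e1 newe -> In x (fv (snd e1)) -> In x (fv r).
Hypothesis th_fv : forall K x, In x (fv (th K)) ->
  (K = F /\ In x (lhs_fv newe)) \/ (x = K /\ K <> F).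
Hypothesis inv : ve_invariant ((Flex F xs, r) :: P0) phi.

Let F_lhs : In F (lhs_fv ((Flex F xs, r) :: P0)).
Proof. simpl; auto. Qed.

Let new_lhs_fresh_eqn e1 K :
  In e1 newe -> In K (fv (fst e1)) -> ~ In K (fv_eqs ((Flex F xs, r) :: P0)).
Proof. intros He1 HK. apply new_lhs_fresh, in_lhs_fv; eauto. Qed.

Lemma eliminate_rigid_lhs_not_in_rhs e1 K :
  In e1 (newe ++ P0) -> In K (lhs_fv (newe ++ P0)) -> ~ In K (fv (snd e1)).
Proof.
  destruct inv as [I1 _ _]. rewrite lhs_fv_app, !in_app_iff. intros He1 [HK|HK] HKs.
  - apply (new_lhs_fresh K HK), in_fv_eqs. destruct He1 as [He1|He1].
    + exists (Flex F xs, r). split; [left; reflexivity | right; eapply new_rhs_fv; eauto].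
    + exists e1. split; [right|right]; assumption.
  - assert (HK' : In K (lhs_fv ((Flex F xs, r) :: P0))) by (simpl; auto).
    destruct He1 as [He1|He1].
    + apply (I1 _ K (or_introl eq_refl) HK'). simpl. eapply new_rhs_fv; eauto.
    + exact (I1 e1 K (or_intror He1) HK' HKs).
Qed.

Lemma eliminate_rigid_lhs_determines_eqn e1 e2 K : In e1 (newe ++ P0) -> In e2 (newe ++ P0) ->
  In K (fv (fst e1)) -> In K (fv (fst e2)) -> e1 = e2.
Proof.
  destruct inv as [_ I2 _]. rewrite !in_app_iff. intros [He1|He1] [He2|He2] H1 H2.
  - eapply new_lhs_unique; eauto.
  - exfalso. apply (new_lhs_fresh_eqn e1 K He1 H1), in_fv_eqs. exists e2; split; [right|left]; auto.
  - exfalso. apply (new_lhs_fresh_eqn e2 K He2 H2), in_fv_eqs. exists e1; split; [right|left]; auto.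
  - apply (I2 e1 e2 K); simpl; auto.
Qed.

Lemma eliminate_rigid_kept_vars_incl :
  incl (kept_vars (newe ++ P0) (Defs.comp phi th)) (kept_vars ((Flex F xs, r) :: P0) phi).
Proof.
  destruct inv as [I1 _ _]. intros x Hx.
  apply in_kept_vars in Hx. destruct Hx as [Hx Hnl]. rewrite lhs_fv_app, in_app_iff in Hnl.
  assert (Hx_old : In x (fv_eqs ((Flex F xs, r) :: P0)) \/ In x (image phi)).
  { destruct Hx as [Hx|Hx].
    - left. apply in_fv_eqs in Hx. destruct Hx as [e1 [He1 [Hx1|Hx1]]]; apply in_app_iff in He1.
      + exfalso. destruct He1 as [He1|He1]; apply Hnl; [left|right]; apply in_lhs_fv; eauto.
      + apply in_fv_eqs. destruct He1 as [He1|He1].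
        * exists (Flex F xs, r). split; [left|right]; simpl; eauto.
        * exists e1. split; [right|]; auto.
    - right. apply in_image in Hx. destruct Hx as [K [HK Hx]].
      apply in_fv_app_sub in Hx. destruct Hx as [K' [HK' Hx]].
      destruct (th_fv K' x Hx) as [[_ Hc]|[-> _]]; [tauto|]. apply in_image; eauto. }
  assert (Hx_F : x <> F).
  { intros ->. destruct Hx as [Hx|Hx].
    - apply in_fv_eqs in Hx. destruct Hx as [e1 [He1 [Hx1|Hx1]]]; apply in_app_iff in He1.
      + destruct He1 as [He1|He1]; apply Hnl; [left|right]; apply in_lhs_fv; eauto.
      + destruct He1 as [He1|He1].
        * apply (I1 (Flex F xs, r) F (or_introl eq_refl) F_lhs). eapply new_rhs_fv; eauto.
        * exact (I1 e1 F (or_intror He1) F_lhs Hx1).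
    - apply in_image in Hx. destruct Hx as [K [HK Hx]].
      apply in_fv_app_sub in Hx. destruct Hx as [K' [HK' Hx]].
      destruct (th_fv K' F Hx) as [[_ Hc]|[E HK'F]]; [tauto | congruence]. }
  apply in_kept_vars. split; [exact Hx_old|].
  change (lhs_fv (_ :: P0)) with ([F] ++ lhs_fv P0). rewrite in_app_iff. simpl. intuition congruence.
Qed.

Lemma ve_invariant_eliminate_rigid : ve_invariant (newe ++ P0) (Defs.comp phi th).
Proof.
  split.
  - exact eliminate_rigid_lhs_not_in_rhs.
  - exact eliminate_rigid_lhs_determines_eqn.
  - eapply Nat.le_trans; [apply card_incl, eliminate_rigid_kept_vars_incl | apply inv].
Qed.

End EliminateRigid.

Section EliminateFlex.
Variables (F G H : fvar) (xs ys : list bv) (P0 : list eqn) (phi th : subst).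
Hypothesis H_fresh : ~ In H (fv_eqs ((Flex F xs, Flex G ys) :: P0)).
Hypothesis th_fv : forall K x, In x (fv (th K)) ->
  (x = H /\ (K = F \/ K = G)) \/ (x = K /\ K <> F /\ K <> G).
Hypothesis th_id : forall K, K <> F -> K <> G -> In K (fv (th K)).
Hypothesis e_notin_P0 : ~ In (Flex F xs, Flex G ys) P0.
Hypothesis inv : ve_invariant ((Flex F xs, Flex G ys) :: P0) phi.

Let in_fv_th t x : In x (fv (app_sub th t)) ->
  (x = H /\ (In F (fv t) \/ In G (fv t))) \/ (In x (fv t) /\ x <> F /\ x <> G).
Proof.
  intros Hx. apply in_fv_app_sub in Hx. destruct Hx as [K [HK Hx]].
  destruct (th_fv K x Hx) as [[-> [->| ->]]|[-> [? ?]]]; auto.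
Qed.

Let G_not_lhs : ~ In G (lhs_fv ((Flex F xs, Flex G ys) :: P0)).
Proof. intros Hc. apply (lhs_fv_not_in_rhs _ _ inv _ G (or_introl eq_refl) Hc). simpl; auto. Qed.

Let lhs_sub_P0 e1 x : In e1 P0 -> In x (fv (app_sub th (fst e1))) -> In x (fv (fst e1)).
Proof.
  intros He1 Hx. destruct (in_fv_th _ _ Hx) as [[_ [HF|HG]]|[Hx' _]]; [exfalso..|exact Hx'].
  - assert (E : (Flex F xs, Flex G ys) = e1).
    { apply (lhs_fv_determines_eqn _ _ inv _ _ F); simpl; auto. }
    subst e1. contradiction.
  - apply G_not_lhs, in_lhs_fv. exists e1; simpl; auto.
Qed.

Lemma eliminate_flex_lhs_fv x :
  In x (lhs_fv (map (sub_eq th) P0)) -> In x (lhs_fv P0).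
Proof.
  rewrite !in_lhs_fv. intros [e1' [He1' Hx]]. apply in_map_iff in He1'.
  destruct He1' as [e1 [<- He1]]. exists e1. split; [exact He1|]. eapply lhs_sub_P0; eauto.
Qed.

Lemma eliminate_flex_lhs_fv_inv x : x <> F -> x <> G ->
  In x (lhs_fv P0) -> In x (lhs_fv (map (sub_eq th) P0)).
Proof.
  intros HF HG. rewrite !in_lhs_fv. intros [e1 [He1 Hx]].
  exists (sub_eq th e1). split; [apply in_map; exact He1|].
  apply in_fv_app_sub. exists x; auto.
Qed.

Lemma eliminate_flex_kept_vars_incl :
  incl (kept_vars (map (sub_eq th) P0) (Defs.comp phi th))
       (H :: remove classic_eq_dec G (kept_vars ((Flex F xs, Flex G ys) :: P0) phi)).
Proof.
  intros x Hx. apply in_kept_vars in Hx. destruct Hx as [Hx Hnl].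
  destruct (fvar_eq_dec x H) as [->|HxH]; [left; reflexivity | right].
  assert (Hx_old : (In x (fv_eqs ((Flex F xs, Flex G ys) :: P0)) \/ In x (image phi))
                   /\ x <> F /\ x <> G).
  { destruct Hx as [Hx|Hx].
    - apply in_fv_eqs in Hx. destruct Hx as [e1' [He1' Hx]]. apply in_map_iff in He1'.
      destruct He1' as [e1 [<- He1]].
      destruct Hx as [Hx|Hx]; destruct (in_fv_th _ _ Hx) as [[? _]|[Hx' [? ?]]];
        try contradiction; (split; [left; apply in_fv_eqs; exists e1; simpl; auto | auto]).
    - apply in_image in Hx. destruct Hx as [K [HK Hx]].
      destruct (in_fv_th _ _ Hx) as [[? _]|[Hx' [? ?]]]; [contradiction|].
      split; [right; apply in_image; eauto | auto]. }
  destruct Hx_old as [Hx_old [HxF HxG]].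
  apply in_in_remove; [exact HxG|]. apply in_kept_vars. split; [exact Hx_old|].
  change (lhs_fv (_ :: P0)) with ([F] ++ lhs_fv P0). rewrite in_app_iff.
  intros [[Hc|[]]|Hc]; [congruence|]. exact (Hnl (eliminate_flex_lhs_fv_inv x HxF HxG Hc)).
Qed.

Lemma ve_invariant_eliminate_flex : ve_invariant (map (sub_eq th) P0) (Defs.comp phi th).
Proof.
  destruct inv as [I1 I2 I3]. split.
  - intros e1' K He1' HK HKs. apply in_map_iff in He1'. destruct He1' as [e1 [<- He1]].
    apply eliminate_flex_lhs_fv in HK. destruct (in_fv_th _ _ HKs) as [[-> _]|[HKs' _]].
    + apply H_fresh, in_fv_eqs. apply in_lhs_fv in HK. destruct HK as [e2 [? ?]].
      exists e2; simpl; auto.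
    + apply (I1 e1 K); simpl; auto.
  - intros e1' e2' K He1' He2' H1 H2. apply in_map_iff in He1'. destruct He1' as [e1 [<- He1]].
    apply in_map_iff in He2'. destruct He2' as [e2 [<- He2]].
    f_equal. apply (I2 e1 e2 K); simpl; eauto using lhs_sub_P0.
  - assert (G_kept : In G (kept_vars ((Flex F xs, Flex G ys) :: P0) phi)).
    { apply in_kept_vars. split; [left; simpl; auto | exact G_not_lhs]. }
    eapply Nat.le_trans; [|exact I3]. unfold card.
    rewrite (set_weight_remove _ G _ G_kept).
    eapply Nat.le_trans; [|apply (set_weight_cons_le (fun _ : fvar => 1) H)].
    apply set_weight_incl, eliminate_flex_kept_vars_incl.
Qed.

End EliminateFlex.

Lemma ve_invariant_VE1 avoid F xs a ss P0 phi ch :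
  length ch = length ss -> NoDup (map fst ch) ->
  Forall (fun H => ~ avoid H /\ ~ used ((Flex F xs, Rig a ss) :: P0) phi H) (map fst ch) ->
  let newe := map (fun p => let '(s, (H, zs)) := p in
                              (Flex H (xs ++ map BAtom zs), open_lams zs s)) (combine ss ch) in
  let args' := map (fun c => let '(H, zs) := c in
                       abstr (map atom_ty zs) (map BAtom zs) (Flex H (xs ++ map BAtom zs))) ch in
  let th : subst := fun K => if fvar_eq_dec K F
                             then abstr (ty_args (fv_ty F)) xs (Rig a args')
                             else eta K in
  ve_invariant ((Flex F xs, Rig a ss) :: P0) phi -> ve_invariant (newe ++ P0) (Defs.comp phi th).
Proof.
  intros Hlen Hnd Hfresh newe args' th Hinv.
  assert (Hnew : forall e1, In e1 newe -> exists s H zs,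
            In (s, (H, zs)) (combine ss ch) /\ e1 = (Flex H (xs ++ map BAtom zs), open_lams zs s)).
  { intros e1 He1. apply in_map_iff in He1. destruct He1 as [[s [H zs]] [<- Hin]]. eauto 6. }
  assert (Hlhs : forall K, In K (lhs_fv newe) <-> In K (map fst ch)).
  { intros K. rewrite in_lhs_fv. split.
    - intros [e1 [He1 HK]]. destruct (Hnew e1 He1) as [s [H [zs [Hin ->]]]].
      destruct HK as [<-|[]]. apply in_combine_r in Hin. exact (in_map fst _ _ Hin).
    - intros HK. apply in_map_iff in HK. destruct HK as [[H zs] [<- Hin]].
      destruct (in_combine_exists_l ss ch (H, zs) (eq_sym Hlen) Hin) as [s Hs].
      exists (Flex H (xs ++ map BAtom zs), open_lams zs s). split; [|left; reflexivity].
      apply in_map_iff. exists (s, (H, zs)); auto. }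
  apply (ve_invariant_eliminate_rigid F xs (Rig a ss) P0 phi newe th); [| | | |exact Hinv].
  - intros K HK Hc. apply Hlhs in HK. rewrite Forall_forall in Hfresh.
    apply (proj2 (Hfresh K HK)). left; exact Hc.
  - intros e1 e2 K He1 He2 H1 H2.
    destruct (Hnew e1 He1) as [s1 [G1 [zs1 [Hin1 ->]]]].
    destruct (Hnew e2 He2) as [s2 [G2 [zs2 [Hin2 ->]]]].
    destruct H1 as [E1|[]]. destruct H2 as [E2|[]]. subst K.
    assert (E : (s1, (G1, zs1)) = (s2, (G2, zs2)))
      by exact (combine_NoDup_map_r fst ss ch _ _ _ _ Hnd Hin1 Hin2 (eq_sym E2)).
    inversion E; subst; reflexivity.
  - intros e1 x He1 Hx. destruct (Hnew e1 He1) as [s [H [zs [Hin ->]]]].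
    simpl in Hx. rewrite fv_open_lams in Hx. rewrite fv_Rig. apply in_flat_map.
    exists s. split; [eapply in_combine_l; eauto | exact Hx].
  - intros K x Hx. unfold th in Hx. destruct (fvar_eq_dec K F) as [->|HKF].
    + left. split; [reflexivity|]. apply Hlhs.
      rewrite fv_abstr, fv_Rig in Hx. apply in_flat_map in Hx. destruct Hx as [u [Hu Hx]].
      apply in_map_iff in Hu. destruct Hu as [[H zs] [<- Hin]].
      rewrite fv_abstr in Hx. destruct Hx as [<-|[]]. exact (in_map fst _ _ Hin).
    + right. rewrite fv_eta in Hx. destruct Hx as [<-|[]]. auto.
Qed.

Lemma ve_invariant_VE2 F xs G ys P0 phi n :
  let ps := filter (fun p => if in_dec bv_eq_dec (fst p) ys then true else false)
                   (combine xs (ty_args (fv_ty F))) in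
  let H := FV n (arrows (map snd ps) (ty_res (fv_ty F))) in
  ~ used ((Flex F xs, Flex G ys) :: P0) phi H ->
  let th : subst := fun K =>
    if fvar_eq_dec K F then abstr (ty_args (fv_ty F)) xs (Flex H (map fst ps))
    else if fvar_eq_dec K G then abstr (ty_args (fv_ty G)) ys (Flex H (map fst ps))
    else eta K in
  ~ In (Flex F xs, Flex G ys) P0 -> ve_invariant ((Flex F xs, Flex G ys) :: P0) phi ->
  ve_invariant (map (sub_eq th) P0) (Defs.comp phi th).
Proof.
  intros ps H Hused th Hn Hinv. apply (ve_invariant_eliminate_flex F G H xs ys); auto.
  - intros Hc; apply Hused; left; exact Hc.
  - intros K x Hx. unfold th in Hx.
    destruct (fvar_eq_dec K F) as [->|HKF]; [|destruct (fvar_eq_dec K G) as [->|HKG]].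
    + left. rewrite fv_abstr in Hx. destruct Hx as [<-|[]]; auto.
    + left. rewrite fv_abstr in Hx. destruct Hx as [<-|[]]; auto.
    + right. rewrite fv_eta in Hx. destruct Hx as [<-|[]]; auto.
  - intros K HKF HKG. unfold th.
    destruct (fvar_eq_dec K F); [contradiction|]. destruct (fvar_eq_dec K G); [contradiction|].
    rewrite fv_eta; left; reflexivity.
Qed.

Lemma ve_step_invariant avoid c c' :
  ve_step avoid c c' -> ve_invariant (fst c) (snd c) -> ve_invariant (fst c') (snd c').
Proof.
  intros [e [P0 [[HP Hn] Hr]]] Hinv.
  apply (ve_invariant_ext _ (e :: P0)) in Hinv; [|intros x; rewrite HP; simpl; intuition].
  destruct Hr.
  - eapply ve_invariant_VE1; eauto.
  - eapply ve_invariant_VE2; eauto.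
Qed.

Lemma ve_steps_invariant avoid c c' : clos_refl_trans _ (ve_step avoid) c c' ->
  ve_invariant (fst c) (snd c) -> ve_invariant (fst c') (snd c').
Proof. induction 1; eauto using ve_step_invariant. Qed.

Lemma varelim_card_image avoid xs phi : ~ In F0 (fv r0) ->
  varelim avoid (Flex F0 xs, r0) phi -> card (image phi) <= card (fv r0).
Proof.
  intros HF Hv. apply card_image_le.
  exact (ve_steps_invariant avoid _ ([], phi) Hv (ve_invariant_init xs HF)).
Qed.

End VarElim.

(** * Termination of HOPSU *)

Definition eqn_flex_count (e : eqn) : nat := flex_count (fst e) + flex_count (snd e).

(* The extra 1 for a non-flexible left-hand side is what rule Ori consumes. *)
Definition eqn_size (e : eqn) : nat :=
  tm_size (fst e) + tm_size (snd e) + match fst e with Flex _ _ => 0 | _ => 1 end.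

Definition measure (P : list eqn) : nat * nat * nat :=
  (card (fv_eqs P), set_weight eqn_flex_count P, set_weight eqn_size P).

Definition lex_lt : relation (nat * nat * nat) := slexprod _ _ (slexprod _ _ lt lt) lt.

Lemma lex_lt_wf : well_founded lex_lt.
Proof. apply wf_slexprod; [apply wf_slexprod|]; apply lt_wf. Qed.

Lemma lex_lt_fst a1 b1 c1 a2 b2 c2 : a1 < a2 -> lex_lt (a1, b1, c1) (a2, b2, c2).
Proof. intros; do 2 apply left_slex; assumption. Qed.

Lemma lex_lt_snd a1 b1 c1 a2 b2 c2 : a1 <= a2 -> b1 < b2 -> lex_lt (a1, b1, c1) (a2, b2, c2).
Proof.
  intros Ha Hb. destruct (le_lt_eq_dec _ _ Ha) as [Ha'|<-]; [apply lex_lt_fst; exact Ha'|].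
  apply left_slex, right_slex; exact Hb.
Qed.

Lemma lex_lt_thd a1 b1 c1 a2 b2 c2 :
  a1 <= a2 -> b1 <= b2 -> c1 < c2 -> lex_lt (a1, b1, c1) (a2, b2, c2).
Proof.
  intros Ha Hb Hc. destruct (le_lt_eq_dec _ _ Hb) as [Hb'|<-]; [apply lex_lt_snd; assumption|].
  destruct (le_lt_eq_dec _ _ Ha) as [Ha'|<-]; [apply lex_lt_fst; exact Ha'|].
  apply right_slex; exact Hc.
Qed.

Lemma measure_ext P Q : (forall e, In e P <-> In e Q) -> measure P = measure Q.
Proof.
  intros HPQ. unfold measure. f_equal; [f_equal|]; apply set_weight_ext; [|exact HPQ..].
  intros x. rewrite !in_fv_eqs. split; intros [e [He Hx]]; exists e; split; auto; apply HPQ; auto.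
Qed.

Lemma measure_cons (e : tm * tm) (P0 : list (tm * tm)) : ~ In e P0 -> measure (e :: P0) =
  (card (fv_eqs (e :: P0)), eqn_flex_count e + set_weight eqn_flex_count P0,
   eqn_size e + set_weight eqn_size P0).
Proof. intros Hn. unfold measure. rewrite !set_weight_cons_notin by exact Hn. reflexivity. Qed.

Lemma list_sum_combine_le {A B} (f : A -> nat) (g : B -> nat) l1 l2 :
  list_sum (map (fun p => f (fst p) + g (snd p)) (combine l1 l2))
  <= list_sum (map f l1) + list_sum (map g l2).
Proof.
  revert l2; induction l1 as [|x l1 IH]; intros [|y l2]; simpl; try lia.
  specialize (IH l2). lia.
Qed.

Lemma measure_Abs a A t s P0 : ~ In (Lam A t, Lam A s) P0 ->
  lex_lt (measure ((open_rec 0 a t, open_rec 0 a s) :: P0)) (measure ((Lam A t, Lam A s) :: P0)).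
Proof.
  intros Hn. rewrite (measure_cons _ _ Hn).
  destruct (open_rec_shape t 0 a) as [f1 [o1 s1]], (open_rec_shape s 0 a) as [f2 [o2 s2]].
  apply lex_lt_thd.
  - apply card_incl. intros x Hx. simpl in *. rewrite f1, f2 in Hx. exact Hx.
  - eapply Nat.le_trans; [apply set_weight_cons_le|]. unfold eqn_flex_count; simpl. lia.
  - eapply Nat.le_lt_trans; [apply set_weight_cons_le|]. unfold eqn_size; simpl.
    rewrite s1, s2. destruct (open_rec 0 a t); lia.
Qed.

Lemma measure_Dec f g ts ss P0 : ~ In (Rig f ts, Rig g ss) P0 ->
  lex_lt (measure (combine ts ss ++ P0)) (measure ((Rig f ts, Rig g ss) :: P0)).
Proof.
  intros Hn. rewrite (measure_cons _ _ Hn). apply lex_lt_thd.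
  - apply card_incl. intros x Hx. apply in_fv_eqs in Hx. apply in_fv_eqs.
    destruct Hx as [[t1 s1] [He1 Hx]]. apply in_app_iff in He1. destruct He1 as [He1|He1].
    + exists (Rig f ts, Rig g ss). split; [left; reflexivity|]. cbn [fst snd] in Hx |- *.
      rewrite !fv_Rig, !in_flat_map.
      destruct Hx as [Hx|Hx]; [left|right]; eexists; split; eauto;
        [eapply in_combine_l | eapply in_combine_r]; eauto.
    + exists (t1, s1); simpl; auto.
  - eapply Nat.le_trans; [apply set_weight_app_le|]. apply Nat.add_le_mono_r.
    change (eqn_flex_count _) with (flex_count (Rig f ts) + flex_count (Rig g ss)).
    rewrite !flex_count_Rig. exact (list_sum_combine_le flex_count flex_count ts ss).
  - eapply Nat.le_lt_trans; [apply set_weight_app_le|]. apply Nat.add_lt_mono_r.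
    change (eqn_size _) with (tm_size (Rig f ts) + tm_size (Rig g ss) + 1).
    rewrite !tm_size_Rig.
    set (size1 := fun u => S (tm_size u)).
    eapply Nat.le_lt_trans; [apply (weight_le_pointwise _ (fun p => size1 (fst p) + size1 (snd p)))|].
    { intros [x y] _. unfold eqn_size, size1; simpl. destruct x; lia. }
    eapply Nat.le_lt_trans; [apply (list_sum_combine_le size1 size1)|].
    lia.
Qed.

Lemma measure_Ori a ss F xs P0 : ~ In (Rig a ss, Flex F xs) P0 ->
  lex_lt (measure ((Flex F xs, Rig a ss) :: P0)) (measure ((Rig a ss, Flex F xs) :: P0)).
Proof.
  intros Hn. rewrite (measure_cons _ _ Hn). apply lex_lt_thd.
  - apply card_incl. intros x Hx. apply in_fv_eqs in Hx; apply in_fv_eqs.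
    destruct Hx as [e1 [[<-|He1] Hx]].
    + exists (Rig a ss, Flex F xs). split; [left; reflexivity|]. simpl in *. tauto.
    + exists e1; simpl; auto.
  - eapply Nat.le_trans; [apply set_weight_cons_le|]. unfold eqn_flex_count; simpl. lia.
  - eapply Nat.le_lt_trans; [apply set_weight_cons_le|]. unfold eqn_size; simpl. lia.
Qed.

Lemma measure_SV F xs ys P0 H th :
  (forall K x, In x (fv (th K)) -> x = H \/ (x = K /\ K <> F)) ->
  (forall K, flex_count (th K) = 1) -> ~ In (Flex F xs, Flex F ys) P0 ->
  lex_lt (measure (map (sub_eq th) P0)) (measure ((Flex F xs, Flex F ys) :: P0)).
Proof.
  intros Hth Hcount Hn. rewrite (measure_cons _ _ Hn). apply lex_lt_snd.
  - assert (HF : In F (fv_eqs ((Flex F xs, Flex F ys) :: P0))) by (simpl; auto).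
    unfold card. rewrite (set_weight_remove _ F _ HF).
    eapply Nat.le_trans; [|apply (set_weight_cons_le (fun _ : fvar => 1) H)].
    apply set_weight_incl. intros x Hx. apply in_fv_eqs_sub in Hx. destruct Hx as [K [HK Hx]].
    destruct (Hth K x Hx) as [->|[-> HKF]]; [left; reflexivity | right].
    apply in_in_remove; [exact HKF|]. apply in_fv_eqs in HK. apply in_fv_eqs.
    destruct HK as [e1 [He1 HK]]. exists e1; simpl; auto.
  - eapply Nat.le_lt_trans; [apply (set_weight_map_le eqn_flex_count)|].
    + intros e1 _. unfold eqn_flex_count, sub_eq; simpl. rewrite !(flex_count_app_sub th Hcount). lia.
    + change (eqn_flex_count (Flex F xs, Flex F ys)) with 2. lia.
Qed.

Lemma measure_LF F xs r P0 phi : ~ In F (fv r) -> card (image F r phi) <= card (fv r) ->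
  lex_lt (measure (map (sub_eq (restrict phi (F :: fv r))) P0)) (measure ((Flex F xs, r) :: P0)).
Proof.
  intros HFr Himage. apply lex_lt_fst.
  set (V := F :: fv r).
  set (others := filter (fun x => if in_dec fvar_eq_dec x V then false else true)
                        (fv_eqs ((Flex F xs, r) :: P0))).
  assert (Hsub : card (fv_eqs (map (sub_eq (restrict phi V)) P0))
                 <= card (image F r phi) + card others).
  { eapply Nat.le_trans; [|apply set_weight_app_le_sum]. apply card_incl. intros x Hx.
    apply in_fv_eqs_sub in Hx. destruct Hx as [K [HK Hx]]. unfold restrict in Hx. apply in_or_app.
    destruct (in_dec fvar_eq_dec K V) as [HV|HV].
    - left. apply in_image. eauto.
    - right. rewrite fv_eta in Hx. destruct Hx as [<-|[]]. unfold others. apply filter_In. split.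
      + apply in_fv_eqs in HK. apply in_fv_eqs. destruct HK as [e1 [He1 HK]]. exists e1; simpl; auto.
      + destruct (in_dec fvar_eq_dec K V); tauto. }
  assert (Hsplit : card V + card others <= card (fv_eqs ((Flex F xs, r) :: P0))).
  { eapply Nat.le_trans; [apply set_weight_app_disjoint|].
    - intros x HV Hx. unfold others in Hx. apply filter_In in Hx.
      destruct Hx as [_ Hx]. destruct (in_dec fvar_eq_dec x V); [discriminate | contradiction].
    - apply card_incl. intros x Hx. apply in_app_or in Hx. destruct Hx as [[<-|Hx]|Hx].
      + simpl; auto.
      + simpl. right. apply in_or_app. left. exact Hx.
      + unfold others in Hx. apply filter_In in Hx. tauto. }
  assert (HV : card V = S (card (fv r))) by (unfold V, card; rewrite set_weight_cons_notin; auto).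
  unfold V in *. lia.
Qed.

Lemma h_rstep_decreases Rs mu P e P0 sg d P' sg' d' :
  sel P e P0 -> h_rstep Rs mu e P0 sg d (Conf P' sg' d') -> lex_lt (measure P') (measure P).
Proof.
  intros [HP Hn] Hr.
  rewrite (measure_ext P (e :: P0)) by (intros x; rewrite HP; simpl; split; intros [Hx|Hx]; auto).
  remember (Conf P' sg' d') as C eqn:EC. destruct Hr; injection EC as <- <- <-.
  - apply measure_Abs; assumption.
  - apply measure_Dec; assumption.
  - eapply measure_SV; [| |assumption]; intros K; unfold th;
      destruct (fvar_eq_dec K F) as [->|HKF].
    + rewrite fv_abstr. intros x [<-|[]]. left; reflexivity.
    + rewrite fv_eta. intros x [<-|[]]. right; auto.
    + apply abstr_shape.
    + apply flex_count_eta.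
  - apply measure_Ori; assumption.
  - apply measure_LF; [assumption|]. eapply varelim_card_image; eassumption.
Qed.

Lemma h_step_Acc Rs mu P sg d : Acc (fun C' C => h_step Rs mu C C') (Conf P sg d).
Proof.
  assert (Bot_Acc : Acc (fun C' C => h_step Rs mu C C') Bot)
    by (constructor; intros C HC; inversion HC).
  revert sg d. induction P as [P IH]
    using (well_founded_induction (wf_inverse_image _ _ lex_lt measure lex_lt_wf)).
  intros sg d. constructor. intros C' Hs.
  inversion Hs as [? ? ? e P0 ? Hsel Hr|]; subst; [|exact Bot_Acc].
  destruct C' as [|P' sg' d']; [exact Bot_Acc|].
  apply IH. eapply h_rstep_decreases; eassumption.
Qed.

Lemma sel_cons_remove (e : eqn) P : sel (e :: P) e (remove classic_eq_dec e P).
Proof.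
  split; [|apply remove_In]. intros x; simpl; split.
  - intros [<-|Hx]; auto. destruct (classic_eq_dec x e) as [->|Hne]; auto.
    right; apply in_in_remove; auto.
  - intros [->|Hx]; auto. apply in_remove in Hx; tauto.
Qed.

Lemma h_step_normal_form Rs mu C :
  (forall C', ~ h_step Rs mu C C') -> C = Bot \/ exists sg d, C = Conf [] sg d.
Proof.
  intros Hnf. destruct C as [|[|e P] sg d]; [left; reflexivity | right; eauto | exfalso].
  destruct (classic (exists C, h_rstep Rs mu e (remove classic_eq_dec e P) sg d C)) as [[C HC]|HC].
  - exact (Hnf C (HS_rule _ _ _ _ _ _ _ _ (sel_cons_remove e P) HC)).
  - apply (Hnf Bot). eapply HS_Fail; [apply sel_cons_remove|]. intros C HC'. apply HC; eauto.
Qed.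

Theorem theorem2 :
  forall (Rs : similarity) (mu : R), (0 < mu <= 1)%R ->
  forall (t s : tm) (T : ty),
    pattern [] t T -> pattern [] s T -> atoms t = [] -> atoms s = [] ->
    Acc (fun C' C => h_step Rs mu C C') (Conf [(t, s)] eps 1%R) /\
    (forall C, clos_refl_trans _ (h_step Rs mu) (Conf [(t, s)] eps 1%R) C ->
       (forall C', ~ h_step Rs mu C C') ->
       C = Bot \/ exists sg d, C = Conf [] sg d).
Proof.
  (* Neither the cut value nor typing plays a role: every problem terminates. *)
  intros Rs mu _ t s T _ _ _ _. split.
  - apply h_step_Acc.
  - intros C _. apply h_step_normal_form.
Qed.
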